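(* Let $\mathbf{k}$ be an algebraically closed field of characteristic zero, and let $\Delta$ and $\Delta'$ be simplicial complexes on $[n]$ and $[n']$. If $X_\Delta\times\mathbb A^1\cong X_{\Delta'}\times\mathbb A^1$ as algebraic varieties, then $\Delta\cong\Delta'$ as abstract simplicial complexes and $X_\Delta\cong X_{\Delta'}$.
   Context: $\mathbf{k}$ is an algebraically closed field of characteristic zero; varieties are over $\mathbf k$. For $n\ge 1$, $[n]=\{1,\dots,n\}$. A simplicial complex $\Delta$ on $[n]$ is a collection of subsets of $[n]$ (faces) closed under taking subsets; it is always assumed that $\{i\}\in\Delta$ for every $i\in[n]$. $\mathbf k[\Delta]=\mathbf k[x_1,\dots,x_n]/I_\Delta$ with $I_\Delta=(\prod_{i\in\sigma}x_i:\sigma\subseteq[n],\sigma\notin\Delta)$, and $X_\Delta=\operatorname{Spec}\mathbf k[\Delta]$. *)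

(* Defs.v *)
From HB Require Import structures.
From mathcomp Require Import all_boot all_order all_algebra.
From mathcomp Require Import generic_quotient ring_quotient.
From mathcomp Require Import boolp classical_sets topology.
From mathcomp Require Import mpoly.
From mathcomp Require Import ring.

Set Implicit Arguments.
Unset Strict Implicit.
Unset Printing Implicit Defensive.

Import GRing.Theory.
Local Open Scope ring_scope.
Local Open Scope quotient_scope.
Local Open Scope classical_set_scope.

(* Sheaf data is indexed by arbitrary subsets, but the sheaf axioms, and later
   isomorphisms, only constrain its values on open sets. *)
Record ringed_space (k : comNzRingType) := RingedSpace {
  space :> topologicalType;
  sheaf : set space -> comPzRingType;
  restr : forall U V : set space, V `<=` U -> {rmorphism sheaf U -> sheaf V};
  scalars : forall U : set space, {rmorphism k -> sheaf U};
  restr_id : forall (U : set space) (UU : U `<=` U) (s : sheaf U),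
    open U -> restr UU s = s;
  restr_comp : forall (U V W : set space)
      (VU : V `<=` U) (WV : W `<=` V) (WU : W `<=` U) (s : sheaf U),
    open U -> open V -> open W -> restr WV (restr VU s) = restr WU s;
  restr_scalars : forall (U V : set space) (VU : V `<=` U) (c : k),
    open U -> open V -> restr VU (scalars U c) = scalars V c;
  sheaf_local : forall (I : Type) (U : I -> set space)
      (s t : sheaf (\bigcup_i U i)), (forall i, open (U i)) ->
    (forall i, restr (@bigcup_sup _ _ i setT U Logic.I) s =
               restr (@bigcup_sup _ _ i setT U Logic.I) t) -> s = t;
  sheaf_glue : forall (I : Type) (U : I -> set space)
      (s : forall i, sheaf (U i)), (forall i, open (U i)) ->
    (forall i j, restr (@subIsetl _ (U i) (U j)) (s i) =
                 restr (@subIsetr _ (U i) (U j)) (s j)) ->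
    exists t : sheaf (\bigcup_i U i),
      forall i, restr (@bigcup_sup _ _ i setT U Logic.I) t = s i
}.

(* An isomorphism of ringed spaces over k. Between locally ringed spaces it is
   an isomorphism of locally ringed spaces: ring isomorphisms on stalks are
   automatically local. *)
Record ringed_space_iso (k : comNzRingType) (X Y : ringed_space k) :=
  RingedSpaceIso {
  iso_map : X -> Y;
  iso_inv : Y -> X;
  iso_mapK : cancel iso_map iso_inv;
  iso_invK : cancel iso_inv iso_map;
  iso_map_continuous : continuous iso_map;
  iso_inv_continuous : continuous iso_inv;
  iso_sheaf : forall U : set Y, open U ->
    {rmorphism sheaf U -> sheaf (iso_map @^-1` U)};
  iso_sheaf_bij : forall (U : set Y) (oU : open U), bijective (iso_sheaf oU);
  iso_sheaf_restr : forall (U V : set Y) (oU : open U) (oV : open V)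
      (VU : V `<=` U) (s : sheaf U),
    iso_sheaf oV (restr VU s) =
      restr (@preimage_subset _ _ iso_map V U VU) (iso_sheaf oU s);
  iso_sheaf_scalars : forall (U : set Y) (oU : open U) (c : k),
    iso_sheaf oU (scalars U c) = scalars (iso_map @^-1` U) c
}.

Definition isomorphic (k : comNzRingType) (X Y : ringed_space k) : Prop :=
  inhabited (ringed_space_iso X Y).

(* The library type prime_idealr A lives in too large a universe to
   be the carrier of a topologicalType. *)
Record spectrum (A : comNzRingType) := Prime {
  prime_pred :> A -> bool;
  prime_idealr_closedP : idealr_closed prime_pred;
  prime_primeP : prime_idealr_closed prime_pred
}.

HB.instance Definition _ (A : comNzRingType) (p : spectrum A) :=
  isIdealr.Build A (prime_pred p) (prime_idealr_closedP p).
HB.instance Definition _ (A : comNzRingType) (p : spectrum A) :=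
  isPrimeIdealrClosed.Build A (prime_pred p) (@prime_primeP A p).

Definition avoids (A : comNzRingType) (p : spectrum A) (f : A) : bool :=
  f \notin prime_pred p.

Lemma avoids1 (A : comNzRingType) (p : spectrum A) : avoids p 1.
Proof. by rewrite /avoids idealr1. Qed.

Lemma avoidsM (A : comNzRingType) (p : spectrum A) (f g : A) :
  avoids p (f * g) = avoids p f && avoids p g.
Proof. by rewrite /avoids prime_idealrM negb_or. Qed.

Section Localization.
Variables (A : comNzRingType) (p : spectrum A).

Definition denominator := {s : A | avoids p s}.

Lemma denominatorM (s t : denominator) : avoids p (val s * val t).
Proof. by rewrite avoidsM (valP s) (valP t). Qed.

Definition den1 : denominator := exist (avoids p) 1 (avoids1 p).
Definition denM (s t : denominator) : denominator :=
  exist (avoids p) _ (denominatorM s t).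

Lemma den1E : val den1 = 1. Proof. by []. Qed.
Lemma denME (s t : denominator) : val (denM s t) = val s * val t.
Proof. by []. Qed.

Implicit Types x y z : (A * denominator)%type.

Definition loc_eq x y := `[< exists u : denominator,
  val u * (x.1 * val y.2 - y.1 * val x.2) = 0 >].

Lemma loc_eq_refl : reflexive loc_eq.
Proof. by move=> x; apply/asboolP; exists den1; rewrite subrr mulr0. Qed.

Lemma loc_eq_sym : ssrbool.symmetric loc_eq.
Proof.
suff S x y : loc_eq x y -> loc_eq y x by move=> x y; apply/idP/idP; apply: S.
move=> /asboolP[u xy]; apply/asboolP; exists u.
by rewrite -opprB mulrN xy oppr0.
Qed.

Lemma loc_eq_trans : transitive loc_eq.
Proof.
move=> y x z /asboolP[u xy] /asboolP[v yz]; apply/asboolP.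
exists (denM (denM u v) y.2); rewrite !denME.
transitivity (val v * val z.2 * (val u * (x.1 * val y.2 - y.1 * val x.2)) +
  val u * val x.2 * (val v * (y.1 * val z.2 - z.1 * val y.2))); first by ring.
by rewrite xy yz !mulr0 addr0.
Qed.

Canonical loc_equiv := EquivRel loc_eq loc_eq_refl loc_eq_sym loc_eq_trans.

Definition localization := {eq_quot loc_eq}.

HB.instance Definition _ : EqQuotient _ loc_eq localization :=
  EqQuotient.on localization.
HB.instance Definition _ := Choice.on localization.

Definition frac (a : A) (s : denominator) : localization :=
  \pi_localization (a, s).

Lemma fracP a s b t : frac a s = frac b t <->
  exists u : denominator, val u * (a * val t - b * val s) = 0.
Proof.
split=> [/eqmodP/asboolP //|ab].
by apply/eqmodP/asboolP.
Qed.

Lemma frac_ind (Q : localization -> Prop) :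
  (forall a s, Q (frac a s)) -> forall x : localization, Q x.
Proof. by move=> Qf x; rewrite -[x]reprK; case: (repr x) => a s; apply: Qf. Qed.

Let numer (x : localization) := (repr x).1.
Let denom (x : localization) := (repr x).2.
Let fracK (x : localization) : frac (numer x) (denom x) = x.
Proof. by rewrite /frac /numer /denom -surjective_pairing reprK. Qed.

Definition loc_add (x y : localization) : localization :=
  frac (numer x * val (denom y) + numer y * val (denom x))
       (denM (denom x) (denom y)).
Definition loc_opp (x : localization) : localization :=
  frac (- numer x) (denom x).
Definition loc_mul (x y : localization) : localization :=
  frac (numer x * numer y) (denM (denom x) (denom y)).

Lemma frac_add a s b t : loc_add (frac a s) (frac b t) =
  frac (a * val t + b * val s) (denM s t).
Proof.
have /fracP[u ux] := fracK (frac a s); have /fracP[v vy] := fracK (frac b t).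
rewrite /loc_add; apply/fracP; exists (denM u v).
move: ux vy; set x := numer _; set x' := denom _; set y := numer _.
set y' := denom _ => ux vy; rewrite !denME.
transitivity (val v * val t * val y' * (val u * (x * val s - a * val x')) +
  val u * val s * val x' * (val v * (y * val t - b * val y'))); first by ring.
by rewrite ux vy !mulr0 addr0.
Qed.

Lemma frac_opp a s : loc_opp (frac a s) = frac (- a) s.
Proof.
have /fracP[u ux] := fracK (frac a s); rewrite /loc_opp; apply/fracP.
by exists u; rewrite !mulNr -opprD mulrN ux oppr0.
Qed.

Lemma frac_mul a s b t : loc_mul (frac a s) (frac b t) =
  frac (a * b) (denM s t).
Proof.
have /fracP[u ux] := fracK (frac a s); have /fracP[v vy] := fracK (frac b t).
rewrite /loc_mul; apply/fracP; exists (denM u v).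
move: ux vy; set x := numer _; set x' := denom _; set y := numer _.
set y' := denom _ => ux vy; rewrite !denME.
transitivity (val v * y * val t * (val u * (x * val s - a * val x')) +
  val u * a * val x' * (val v * (y * val t - b * val y'))); first by ring.
by rewrite ux vy !mulr0 addr0.
Qed.

Let eq_frac a s b t : a * val t = b * val s -> frac a s = frac b t.
Proof. by move=> e; apply/fracP; exists den1; rewrite e subrr mulr0. Qed.

Let loc_addA : associative loc_add.
Proof.
elim/frac_ind=> a s; elim/frac_ind=> b t; elim/frac_ind=> c u.
by rewrite !frac_add; apply: eq_frac; rewrite ?(denME, den1E); ring.
Qed.

Let loc_addC : commutative loc_add.
Proof.
elim/frac_ind=> a s; elim/frac_ind=> b t.
by rewrite !frac_add; apply: eq_frac; rewrite ?(denME, den1E); ring.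
Qed.

Let loc_add0 : left_id (frac 0 den1) loc_add.
Proof. by elim/frac_ind=> a s; rewrite frac_add; apply: eq_frac; rewrite ?(denME, den1E); ring. Qed.

Let loc_addN : left_inverse (frac 0 den1) loc_opp loc_add.
Proof.
elim/frac_ind=> a s; rewrite frac_opp frac_add.
by apply: eq_frac; rewrite ?(denME, den1E); ring.
Qed.

HB.instance Definition _ := GRing.isZmodule.Build localization
  loc_addA loc_addC loc_add0 loc_addN.

Let loc_mulA : associative loc_mul.
Proof.
elim/frac_ind=> a s; elim/frac_ind=> b t; elim/frac_ind=> c u.
by rewrite !frac_mul; apply: eq_frac; rewrite ?(denME, den1E); ring.
Qed.

Let loc_mulC : commutative loc_mul.
Proof.
elim/frac_ind=> a s; elim/frac_ind=> b t.
by rewrite !frac_mul; apply: eq_frac; rewrite ?(denME, den1E); ring.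
Qed.

Let loc_mul1 : left_id (frac 1 den1) loc_mul.
Proof. by elim/frac_ind=> a s; rewrite frac_mul; apply: eq_frac; rewrite ?(denME, den1E); ring. Qed.

Let loc_mulD : left_distributive loc_mul loc_add.
Proof.
elim/frac_ind=> a s; elim/frac_ind=> b t; elim/frac_ind=> c u.
by rewrite !(frac_mul, frac_add); apply: eq_frac; rewrite ?(denME, den1E); ring.
Qed.

Let loc_1neq0 : frac 1 den1 != 0.
Proof.
apply/eqP => /fracP[u /eqP]; rewrite mul0r subr0 !mulr1 => /eqP u0.
by have := valP u; rewrite u0 /avoids idealr0.
Qed.

HB.instance Definition _ := GRing.Zmodule_isComNzRing.Build localization
  loc_mulA loc_mulC loc_mul1 loc_mulD loc_1neq0.

Lemma addfrac a s b t : frac a s + frac b t =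
  frac (a * val t + b * val s) (denM s t).
Proof. exact: frac_add. Qed.

Lemma oppfrac a s : - frac a s = frac (- a) s.
Proof. exact: frac_opp. Qed.

Lemma mulfrac a s b t : frac a s * frac b t = frac (a * b) (denM s t).
Proof. exact: frac_mul. Qed.

Lemma frac11 : frac 1 den1 = 1. Proof. by []. Qed.
Lemma frac01 : frac 0 den1 = 0. Proof. by []. Qed.

End Localization.

(* A set of primes is open iff it is the complement of some V(S). *)
Section Zariski.
Variable A : comNzRingType.

HB.instance Definition _ := gen_eqMixin (spectrum A).
HB.instance Definition _ := gen_choiceMixin (spectrum A).

Definition zariski_open (U : set (spectrum A)) : Prop :=
  exists S : set A, U = [set p | exists2 f, S f & avoids p f].

Let zariski_openT : zariski_open setT.
Proof.
exists [set 1]; apply/seteqP; split=> // p _.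
by exists 1; [|apply: avoids1].
Qed.

Let zariski_openI : setI_closed zariski_open.
Proof.
move=> _ _ [S ->] [T ->].
exists [set x | exists f g, [/\ S f, T g & x = f * g]].
apply/seteqP; split=> p /=.
  move=> [[f Sf pf] [g Tg pg]]; exists (f * g); first by exists f, g.
  by rewrite avoidsM pf.
move=> [_ [f [g [Sf Tg ->]]]]; rewrite avoidsM.
by case/andP=> pf pg; split; [exists f | exists g].
Qed.

Let zariski_openU (I : Type) (U : I -> set (spectrum A)) :
  (forall i, zariski_open (U i)) -> zariski_open (\bigcup_i U i).
Proof.
move=> oU; have [S US] := choice oU; exists (\bigcup_i S i).
apply/seteqP; split=> p /=.
  by move=> [i _]; rewrite US => -[f Sf pf]; exists f => //; exists i.
by move=> [f [i _] Sf pf]; exists i => //; rewrite US; exists f.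
Qed.

HB.instance Definition _ := isOpenTopological.Build (spectrum A)
  zariski_openT zariski_openI zariski_openU.

Lemma zariski_openE (U : set (spectrum A)) : open U = zariski_open U.
Proof. by []. Qed.

End Zariski.

Section StructureSheaf.
Variable A : comNzRingType.

Section Sections.
Variable U : set (spectrum A).

Definition germs := forall x : {p | U p}, localization (sval x).
HB.instance Definition _ := Choice.on germs.

Let germs0 : germs := fun=> 0.
Let germs_opp (s : germs) : germs := fun x => - s x.
Let germs_add (s t : germs) : germs := fun x => s x + t x.
Let germs1 : germs := fun=> 1.
Let germs_mul (s t : germs) : germs := fun x => s x * t x.

Let germs_addA : associative germs_add.
Proof. by move=> s t r; apply: functional_extensionality_dep => x; apply: addrA. Qed.
Let germs_addC : commutative germs_add.
Proof. by move=> s t; apply: functional_extensionality_dep => x; apply: addrC. Qed.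
Let germs_add0 : left_id germs0 germs_add.
Proof. by move=> s; apply: functional_extensionality_dep => x; apply: add0r. Qed.
Let germs_addN : left_inverse germs0 germs_opp germs_add.
Proof. by move=> s; apply: functional_extensionality_dep => x; apply: addNr. Qed.

HB.instance Definition _ := GRing.isZmodule.Build germs
  germs_addA germs_addC germs_add0 germs_addN.

Let germs_mulA : associative germs_mul.
Proof. by move=> s t r; apply: functional_extensionality_dep => x; apply: mulrA. Qed.
Let germs_mulC : commutative germs_mul.
Proof. by move=> s t; apply: functional_extensionality_dep => x; apply: mulrC. Qed.
Let germs_mul1 : left_id germs1 germs_mul.
Proof. by move=> s; apply: functional_extensionality_dep => x; apply: mul1r. Qed.
Let germs_mulD : left_distributive germs_mul germs_add.
Proof. by move=> s t r; apply: functional_extensionality_dep => x; apply: mulrDl. Qed.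

HB.instance Definition _ := GRing.Zmodule_isComPzRing.Build germs
  germs_mulA germs_mulC germs_mul1 germs_mulD.

(* On W, the family s is given by the single fraction f / g. *)
Definition is_frac_on (s : germs) (W : set (spectrum A)) (f g : A) : Prop :=
  forall x : {p | U p}, W (sval x) ->
    exists gx : avoids (sval x) g, s x = frac f (exist _ g gx).

Definition regular : {pred germs} := fun s => `[< forall x : {p | U p},
  exists W f g, [/\ open W, W (sval x) & is_frac_on s W f g] >].

Lemma regularP (s : germs) : reflect (forall x : {p | U p},
  exists W f g, [/\ open W, W (sval x) & is_frac_on s W f g]) (s \in regular).
Proof. exact: asboolP. Qed.

Lemma germs_irr (s : germs) (p : spectrum A) (Up Up' : U p) :
  s (exist U p Up) = s (exist U p Up') :> localization p.
Proof. by rewrite (Prop_irrelevance Up Up'). Qed.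

Lemma frac_eqE (p : spectrum A) a (s t : denominator p) :
  val s = val t -> frac a s = frac a t.
Proof. by move=> st; congr frac; apply: val_inj. Qed.

Lemma regular_subring : subring_closed regular.
Proof.
split.
- apply/regularP => x; exists setT, 1, 1; split=> //; first exact: openT.
  move=> y _; have y1 := avoids1 (sval y).
  by exists y1; rewrite -[LHS]frac11; apply: frac_eqE.
- move=> s t /regularP rs /regularP rt; apply/regularP => x.
  have [W [f [g [oW Wx sW]]]] := rs x; have [V [a [b [oV Vx tV]]]] := rt x.
  exists (W `&` V), (f * b - a * g), (g * b); split=> //; first exact: openI.
  move=> y [Wy Vy]; have [gy sy] := sW y Wy; have [bt ty] := tV y Vy.
  have gby : avoids (sval y) (g * b).
    by rewrite avoidsM; apply/andP.
  exists gby; rewrite -[LHS]/(s y - t y) sy ty oppfrac addfrac /= mulNr.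
  exact: frac_eqE.
- move=> s t /regularP rs /regularP rt; apply/regularP => x.
  have [W [f [g [oW Wx sW]]]] := rs x; have [V [a [b [oV Vx tV]]]] := rt x.
  exists (W `&` V), (f * a), (g * b); split=> //; first exact: openI.
  move=> y [Wy Vy]; have [gy sy] := sW y Wy; have [bt ty] := tV y Vy.
  have gby : avoids (sval y) (g * b).
    by rewrite avoidsM; apply/andP.
  exists gby; rewrite -[LHS]/(s y * t y) sy ty mulfrac.
  exact: frac_eqE.
Qed.

HB.instance Definition _ := GRing.isSubringClosed.Build germs regular
  regular_subring.

Record sections := Section { germ :> germs; germ_regular : germ \in regular }.
HB.instance Definition _ := [isSub for germ].
HB.instance Definition _ := [Choice of sections by <:].
HB.instance Definition _ := GRing.SubChoice_isSubComPzRing.Build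
  germs regular sections (subringClosedP _).

Lemma sectionsP (s t : sections) : (forall x, germ s x = germ t x) -> s = t.
Proof.
by move=> st; apply: val_inj; apply: functional_extensionality_dep.
Qed.

Definition const_germs (a : A) : germs := fun x => frac a (den1 (sval x)).

Lemma const_germs_regular (a : A) : const_germs a \in regular.
Proof.
apply/regularP => x; exists setT, a, 1; split=> //; first exact: openT.
by move=> y _; exists (avoids1 (sval y)); apply: frac_eqE.
Qed.

Definition const_section (a : A) : sections := Section (const_germs_regular a).

Lemma const_section_zmod : zmod_morphism const_section.
Proof.
move=> a b; apply: sectionsP => x.
rewrite -[RHS]/(const_germs a x - const_germs b x) oppfrac addfrac !mulr1.
by apply: frac_eqE; rewrite /= mulr1.
Qed.

Lemma const_section_monoid : monoid_morphism const_section.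
Proof.
split=> [|a b]; apply: sectionsP => x //.
rewrite -[RHS]/(const_germs a x * const_germs b x) mulfrac.
by apply: frac_eqE; rewrite /= mulr1.
Qed.

HB.instance Definition _ := GRing.isZmodMorphism.Build A sections const_section
  const_section_zmod.
HB.instance Definition _ := GRing.isMonoidMorphism.Build A sections
  const_section const_section_monoid.

End Sections.

Arguments regular U _ : clear implicits.

Section Restriction.
Variables (U V : set (spectrum A)) (VU : V `<=` U).

Definition restr_germs (s : germs U) : germs V :=
  fun x => s (exist U (sval x) (VU (svalP x))).

Lemma restr_germs_regular (s : germs U) :
  s \in regular U -> restr_germs s \in regular V.
Proof.
move=> /regularP rs; apply/regularP => x.
have [W [f [g [oW Wx sW]]]] := rs (exist U (sval x) (VU (svalP x))).
by exists W, f, g; split=> // y Wy; apply: (sW (exist U _ _)).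
Qed.

Definition restr_section (s : sections U) : sections V :=
  Section (restr_germs_regular (germ_regular s)).

Lemma restr_section_zmod : zmod_morphism restr_section.
Proof. by move=> s t; apply: sectionsP. Qed.

Lemma restr_section_monoid : monoid_morphism restr_section.
Proof. by split=> [|s t]; apply: sectionsP. Qed.

HB.instance Definition _ := GRing.isZmodMorphism.Build (sections U) (sections V)
  restr_section restr_section_zmod.
HB.instance Definition _ := GRing.isMonoidMorphism.Build (sections U)
  (sections V) restr_section restr_section_monoid.

End Restriction.

Lemma restr_section_id (U : set (spectrum A)) (UU : U `<=` U) (s : sections U) :
  restr_section UU s = s.
Proof.
by apply: sectionsP => -[p Up]; apply: (germs_irr (germ s)).
Qed.

Lemma restr_section_comp (U V W : set (spectrum A))
    (VU : V `<=` U) (WV : W `<=` V) (WU : W `<=` U) (s : sections U) :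
  restr_section WV (restr_section VU s) = restr_section WU s.
Proof.
by apply: sectionsP => -[p Wp]; apply: (germs_irr (germ s)).
Qed.

Lemma sections_local (I : Type) (U : I -> set (spectrum A))
    (s t : sections (\bigcup_i U i)) :
  (forall i, restr_section (@bigcup_sup _ _ i setT U Logic.I) s =
             restr_section (@bigcup_sup _ _ i setT U Logic.I) t) -> s = t.
Proof.
move=> st; apply: sectionsP => -[p Up]; have [i _ Uip] := Up.
have := congr1 (fun r : sections (U i) => germ r (exist _ p Uip)) (st i).
by move=> e; apply: etrans (germs_irr (germ s) _ _)
  (etrans e (germs_irr (germ t) _ _)).
Qed.

Lemma sections_glue (I : Type) (U : I -> set (spectrum A))
    (s : forall i, sections (U i)) : (forall i, open (U i)) ->
  (forall i j, restr_section (@subIsetl _ (U i) (U j)) (s i) =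
               restr_section (@subIsetr _ (U i) (U j)) (s j)) ->
  exists t : sections (\bigcup_i U i),
    forall i, restr_section (@bigcup_sup _ _ i setT U Logic.I) t = s i.
Proof.
move=> oU sij.
pose index (x : {p | (\bigcup_i U i) p}) := cid2 (svalP x).
pose t : germs (\bigcup_i U i) :=
  fun x => germ (s _) (exist (U _) (sval x) (s2valP' (index x))).
have tE i p (Up : (\bigcup_i U i) p) (Uip : U i p) :
    t (exist _ p Up) = germ (s i) (exist _ p Uip).
  have agree j (Ujp : U j p) :
      germ (s j) (exist _ p Ujp) = germ (s i) (exist _ p Uip).
    have := congr1 (fun r : sections (U j `&` U i) =>
      germ r (exist _ p (conj Ujp Uip))) (sij j i).
    move=> e; exact: etrans (germs_irr (germ (s j)) _ _)
      (etrans e (germs_irr (germ (s i)) _ _)).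
  exact: agree.
have rt : t \in regular (\bigcup_i U i).
  apply/regularP => -[p Up]; have [i _ Uip] := Up.
  have /regularP /(_ (exist _ p Uip)) := germ_regular (s i).
  move=> [W [f [g [oW Wp sW]]]]; exists (W `&` U i), f, g.
  split=> //; first exact: openI.
  move=> [q Uq] [Wq Uiq]; have [gq sq] := sW (exist _ q Uiq) Wq.
  by exists gq; rewrite -[LHS]/(t (exist _ q Uq)) (tE i q Uq Uiq).
exists (Section rt) => i; apply: sectionsP => -[p Uip] /=.
exact: tE.
Qed.

End StructureSheaf.

(* A k-algebra, as a commutative ring with a structure morphism. *)
Record calgebra (k : comNzRingType) := CAlgebra {
  carrier :> comNzRingType;
  structure_map : {rmorphism k -> carrier}
}.

Definition Spec (k : comNzRingType) (A : calgebra k) : ringed_space k.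
Proof.
refine (@RingedSpace k (spectrum A) (@sections A) (@restr_section A)
  (fun U => @const_section A U \o structure_map A) _ _ _ _ _).
- by move=> U UU s _; apply: restr_section_id.
- by move=> U V W VU WV WU s _ _ _; apply: restr_section_comp.
- by move=> U V VU c _ _; apply: sectionsP.
- by move=> I U s t _; apply: sections_local.
- exact: sections_glue.
Defined.

(* The polynomial ring A[t]: since A[t] is the tensor product of A and k[t]
   over k, Spec A[t] is the fibre product over k of Spec A and the affine line
   Spec k[t]. *)
Definition poly_algebra (k : comNzRingType) (A : calgebra k) : calgebra k :=
  CAlgebra (@polyC A \o structure_map A).

Section StanleyReisner.
Variable n : nat.

(* The vertex set is 'I_n, so vertices are numbered from 0. *)
Record simplicial_complex := SimplicialComplex {
  faces :> {set {set 'I_n}};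
  ground_gt0 : (0 < n)%N;
  faces_closed : forall sigma tau : {set 'I_n},
    sigma \in faces -> tau \subset sigma -> tau \in faces;
  faces_vertex : forall i : 'I_n, [set i]%SET \in faces
}.

End StanleyReisner.

Definition ideal_generated (R : comNzRingType) (S : set R) : R -> bool :=
  fun x => `[< exists c : seq (R * R),
    (forall y, y \in c -> S y.2) /\ x = \sum_(y <- c) y.1 * y.2 >].

Section StanleyReisnerRing.
Variables (k : fieldType) (n : nat) (Delta : simplicial_complex n).

Definition nonface_monomials : set {mpoly k[n]} :=
  [set m | exists2 sigma : {set 'I_n},
    sigma \notin (faces Delta) & m = \prod_(i in sigma) 'X_i].

Definition SR_ideal : {mpoly k[n]} -> bool := ideal_generated nonface_monomials.

Lemma SR_ideal_closed : idealr_closed SR_ideal.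
Proof.
split.
- by apply/asboolP; exists [::]; split=> //; rewrite big_nil.
- apply/negP => /asboolP[c [cS /(congr1 (fun p => p.@[fun=> 0]))]].
  rewrite meval1 raddf_sum big_seq big1 /=; first by move/eqP; rewrite oner_eq0.
  move=> y yc; rewrite mevalM; have [sigma sD ->] := cS y yc.
  have [e|[i si]] := set_0Vmem sigma.
    move/negP: sD; case; rewrite e.
    pose i0 := Ordinal (ground_gt0 Delta).
    exact: faces_closed (faces_vertex Delta i0) (finset.sub0set _).
  rewrite rmorph_prod (bigD1 i) //= mevalXU !(mul0r, mulr0) //.
- move=> a u v /asboolP[c [cS ->]] /asboolP[d [dS ->]]; apply/asboolP.
  exists ([seq (a * y.1, y.2) | y <- c] ++ d); split.
    move=> y; rewrite mem_cat => /orP[/mapP[z zc ->]|yd]; last exact: dS.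
    exact: cS z zc.
  rewrite big_cat big_map mulr_sumr /=.
  by congr (_ + _); apply: eq_bigr => y _; rewrite mulrA.
Qed.

HB.instance Definition _ := isIdealr.Build {mpoly k[n]} SR_ideal
  SR_ideal_closed.

Definition SR_ring : comNzRingType :=
  {ideal_quot (SR_ideal : idealr {mpoly k[n]})}.

Definition SR_algebra : calgebra k :=
  @CAlgebra k SR_ring
    (\pi_({ideal_quot (SR_ideal : idealr {mpoly k[n]})}) \o @mpolyC n k).

End StanleyReisnerRing.

Definition simplicial_iso (n n' : nat)
    (Delta : simplicial_complex n) (Delta' : simplicial_complex n') : Prop :=
  exists2 f : 'I_n -> 'I_n', bijective f &
    forall sigma : {set 'I_n},
      (sigma \in faces Delta) = (f @: sigma \in faces Delta').

Definition SR_scheme (k : fieldType) (n : nat)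
    (Delta : simplicial_complex n) : ringed_space k :=
  Spec (SR_algebra k Delta).

Definition SR_scheme_times_A1 (k : fieldType) (n : nat)
    (Delta : simplicial_complex n) : ringed_space k :=
  Spec (poly_algebra (SR_algebra k Delta)).

(* Main.v *)
From HB Require Import structures.
From mathcomp Require Import all_boot all_order all_algebra.
From mathcomp Require Import generic_quotient ring_quotient.
From mathcomp Require Import boolp classical_sets topology.
From mathcomp Require Import mpoly.
From mathcomp Require Import zify.
From mathcomp Require Import perm fintype finset.
Require Import Defs.

(** The complex Delta can be read off from the topological space of
    X_Delta x A^1, even from the inclusion order on its primes.

    The ring k[Delta][t] is the Stanley-Reisner ring of the cone over Delta, with
    apex t. Its spectrum is the union of the coordinate subspaces of the faces of
    the cone, each of them irreducible ([SR_stratified]). The minimal primes are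
    the generic points of the subspaces of the facets, so an order isomorphism
    between two such spectra matches the facets ([facet_transfer]). For a nonempty
    family of facets, the smallest prime above the corresponding minimal primes is
    the generic point of the subspace of their intersection. The dimension of that
    subspace is the number of vertices in the intersection, and it is the largest
    length of a chain of primes above its generic point. Hence corresponding
    families of facets have intersections of the same size ([meet_transfer]).

    That chains are no longer than the dimension follows from two facts: a chain
    of length m yields m elements that are algebraically independent modulo its
    first prime ([chain_alg_independent]), and more than d polynomials in d
    variables are algebraically dependent ([mpoly_alg_dependent]).

    By inclusion-exclusion, for every nonempty set of facets, the number of
    vertices that lie in exactly these facets is the same on both sides. The
    apexes lie in all facets, and can be removed from the count without knowing
    that the isomorphism relates them. What is left is a bijection of the vertices
    of Delta and Delta' that preserves facets ([cone_reconstruction]).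

    An isomorphism of complexes permutes variables and so induces an isomorphism
    of Stanley-Reisner rings over k, hence of their spectra
    ([SR_scheme_isomorphic]). *)

Set Implicit Arguments.
Unset Strict Implicit.
Unset Printing Implicit Defensive.

Import GRing.Theory.
Local Open Scope ring_scope.

(** * Algebraic dependence of polynomials *)
Section Evaluation.
Variables (k R : comNzRingType) (iota : {rmorphism k -> R}).

(** Evaluating at a point can be done one variable at a time: [muni] isolates
    the last one. *)
Lemma mmap_muni n (y : 'I_n.+1 -> R) (G : {mpoly k[n.+1]}) :
  mmap iota y G =
    (map_poly (mmap iota (fun i => y (widen_ord (leqnSn n) i))) (muni G)).[y ord_max].
Proof.
rewrite muniE [mmap iota y G]/mmap raddf_sum horner_sum; apply: eq_bigr => m _.
rewrite /= map_polyZ map_polyXn hornerZ hornerXn /= mmapZ.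
rewrite mmapX -mulrA; congr (_ * _).
rewrite /mmap1 big_ord_recr /=; congr (_ * _).
by apply: eq_bigr => i _; rewrite mnmE.
Qed.

Lemma mmap_comp n d (z : 'I_n -> R) (g : 'I_d -> {mpoly k[n]}) G :
  mmap iota z (mmap (@mpolyC n k) g G) = mmap iota (fun i => mmap iota z (g i)) G.
Proof.
rewrite [mmap _ g G]/mmap raddf_sum; apply: eq_bigr => m _ /=.
rewrite mul_mpolyC mmapZ rmorph_prod; congr (_ * _).
by apply: eq_bigr => i _; rewrite rmorphXn.
Qed.

End Evaluation.

(** [mmap_muni] at the tautological point, where y i is the variable X_i, recovers
    G from [muni G]. *)
Lemma muni_neq0 (k : comNzRingType) n (G : {mpoly k[n.+1]}) :
  G != 0 -> muni G != 0.
Proof.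
apply: contra_neq => G0.
have <- : mmap (@mpolyC n.+1 k) (fun i => 'X_i) G = G.
  rewrite /mmap [RHS]mpolyE; apply: eq_bigr => m _.
  by rewrite mmap1_id mul_mpolyC.
by rewrite mmap_muni G0 rmorph0 horner0.
Qed.

Section AlgebraicDependence.
Variable k : fieldType.

Lemma msize_prodX_le n d (g : 'I_d -> {mpoly k[n]}) (c D : nat) (e : 'I_d -> nat) :
    (forall i, msize (g i) <= c.+1)%N -> (forall i, e i <= D)%N ->
  (msize (\prod_i g i ^+ e i) <= (d * (D * c)).+1)%N.
Proof.
move=> gc eD.
have sM (p q : {mpoly k[n]}) a b :
    (msize p <= a.+1 -> msize q <= b.+1 -> msize (p * q) <= (a + b).+1)%N.
  have [->|p0] := eqVneq p 0; first by rewrite mul0r msize0.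
  have [->|q0] := eqVneq q 0; first by rewrite mulr0 msize0.
  rewrite msizeM //; move: (msize p) (msize q) => x y xa yb; lia.
have sX i j : (msize (g i ^+ j) <= (j * c).+1)%N.
  elim: j => [|j IH]; first by rewrite expr0 msize1.
  by rewrite exprS mulSn; apply: sM.
have -> : (d * (D * c) = \sum_(i < d) D * c)%N.
  by rewrite sum_nat_const card_ord.
elim/big_ind2: _ => [|p a q b pa qb|i _]; first by rewrite msize1.
  exact: sM.
by apply: leq_trans (sX i _) _; rewrite ltnS leq_mul2r eD orbT.
Qed.

(** A count of dimensions. There are (D + 1) ^ d products of the g i with all
    exponents at most D, while their exponents in the n < d variables grow only
    linearly in D; so for large D these products outnumber the monomials
    available to them and are linearly dependent. *)
Lemma mpoly_alg_dependent n d (g : 'I_d -> {mpoly k[n]}) : (n < d)%N ->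
  exists2 G : {mpoly k[d]}, G != 0 & mmap (@mpolyC n k) g G = 0.
Proof.
move=> nd.
pose c := (\max_i msize (g i))%N.
have gc i : (msize (g i) <= c.+1)%N by apply/leqW/leq_bigmax.
(* N = d D c + 1 bounds the exponents that occur. As N <= (D + 1) b, it suffices
   that b ^ n < D + 1 to get N ^ n < (D + 1) ^ d. *)
pose b := (d * c).+1; pose D := (b ^ n)%N; pose N := (d * (D * c)).+1.
pose E := {ffun 'I_d -> 'I_D.+1}; pose F := {ffun 'I_n -> 'I_N}.
have FE : (#|{: F}| < #|{: E}|)%N.
  rewrite !card_ffun !card_ord.
  have Nb : (N <= D.+1 * b)%N by rewrite /N /b; nia.
  apply: (@leq_trans (D.+1 ^ n.+1)%N); last by rewrite leq_pexp2l.
  apply: (@leq_ltn_trans ((D.+1 * b) ^ n)%N).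
    by case: (n) => // n0; rewrite leq_exp2r.
  by rewrite expnMn expnSr ltn_pmul2l ?expn_gt0.
pose v (e : E) := \prod_i g i ^+ e i.
pose mon (f : F) : 'X_{1..n} := [multinom (f i : nat) | i < n].
pose M := \matrix_(i < #|{: E}|, j < #|{: F}|) (v (enum_val i))@_(mon (enum_val j)).
have [u u0 uM] : exists2 u : 'rV_#|{: E}|, u != 0 & u *m M = 0.
  have : kermx M != 0.
    rewrite -mxrank_eq0 mxrank_ker subn_eq0 -ltnNge.
    exact: leq_ltn_trans (rank_leq_col M) FE.
  case/rowV0Pn=> u /sub_kermxP uM u0; by exists u.
pose me (i : 'I_#|{: E}|) : 'X_{1..d} := [multinom (enum_val i l : nat) | l < d].
have me_inj : injective me.
  move=> i j /mnmP ij; apply: enum_val_inj; apply/ffunP => l; apply: val_inj.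
  by have := ij l; rewrite !mnmE.
pose G := \sum_i u 0 i *: 'X_[me i] : {mpoly k[d]}.
have GE i : G@_(me i) = u 0 i.
  rewrite /G raddf_sum (bigD1 i) //= mcoeffZ mcoeffX eqxx mulr1 big1 ?addr0 //.
  move=> j ji; rewrite mcoeffZ mcoeffX (inj_eq me_inj) (negPf ji) mulr0 //.
exists G.
  apply: contra_neq u0 => G0; apply/rowP => i.
  by rewrite -GE G0 mcoeff0 mxE.
have -> : mmap (@mpolyC n k) g G = \sum_i u 0 i *: v (enum_val i).
  rewrite /G raddf_sum; apply: eq_bigr => i _ /=.
  rewrite mmapZ mmapX mul_mpolyC; congr (_ *: _).
  by apply: eq_bigr => l _; rewrite mnmE.
apply/mpolyP => m; rewrite mcoeff0 raddf_sum /=.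
(* A monomial outside the box of side N occurs in none of the products; inside
   the box its coefficient vanishes by the choice of u. *)
have [mN|Nm] := boolP [forall i, m i < N]%N; last first.
  rewrite big1 // => i _; rewrite mcoeffZ.
  suff -> : (v (enum_val i))@_m = 0 by rewrite mulr0.
  apply: memN_msupp_eq0; apply: contraNN Nm => /msize_mdeg_lt mv.
  apply/forallP => l; apply: (@leq_ltn_trans (mdeg m)).
    by rewrite mdegE (bigD1 l) //= leq_addr.
  apply: leq_trans mv _; apply: msize_prodX_le => // j.
  by rewrite -ltnS.
have /forallP mN' := mN; pose f : F := [ffun i => Ordinal (mN' i)].
have <- : mon f = m by apply/mnmP => l; rewrite mnmE ffunE.
have := congr1 (fun A : 'rV_#|{: F}| => A 0 (enum_rank f)) uM; rewrite !mxE => uf.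
rewrite -[RHS]uf; apply: eq_bigr => i _.
by rewrite mcoeffZ mxE enum_rankK.
Qed.
End AlgebraicDependence.

(** * Prime ideals, specialization and chains *)

(** Inclusion of the ideal p in the ideal q, stated through the complements, in
    terms of which the open sets are described. *)
Definition spec_le (A : comNzRingType) (p q : spectrum A) : Prop :=
  forall a, avoids q a -> avoids p a.

Lemma spec_le_trans (A : comNzRingType) (q p r : spectrum A) :
  spec_le p q -> spec_le q r -> spec_le p r.
Proof. by move=> pq qr a /qr/pq. Qed.

(** Inclusion of primes is the specialization order of the Zariski topology, hence
    respected by every continuous map. *)
Lemma continuous_spec_le (A B : comNzRingType) (phi : spectrum A -> spectrum B) :
  continuous phi -> {homo phi : p q / spec_le p q}.
Proof.
move=> cphi p q pq b qb.
have ob : open ([set r | avoids r b]%classic : set (spectrum B)).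
  exists [set b]%classic; apply/seteqP; split=> r /=; first by exists b.
  by move=> [_ ->].
have [S SE] : zariski_open (phi @^-1` [set r | avoids r b])%classic.
  by move/continuousP: cphi; apply.
have : (phi @^-1` [set r | avoids r b])%classic q by [].
rewrite SE => -[f Sf /pq pf].
have : (phi @^-1` [set r | avoids r b])%classic p by rewrite SE; exists f.
by [].
Qed.

(** The Krull dimension of the closure of p is the supremum of these m. *)
Fixpoint has_chain (A : comNzRingType) (p : spectrum A) (m : nat) : Prop :=
  if m is m'.+1 then
    exists q, [/\ spec_le p q, ~ spec_le q p & has_chain q m']
  else True.

Lemma has_chain_le (A : comNzRingType) (p q : spectrum A) m :
  spec_le p q -> has_chain q m -> has_chain p m.
Proof.
case: m => //= m pq [r [qr rq rm]]; exists r; split=> //.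
  exact: spec_le_trans pq qr.
by move=> rp; apply/rq/(spec_le_trans rp).
Qed.

Lemma has_chain_iso (A B : comNzRingType) (phi : spectrum A -> spectrum B)
    (psi : spectrum B -> spectrum A) :
    cancel phi psi -> {homo phi : p q / spec_le p q} ->
    {homo psi : p q / spec_le p q} ->
  forall m p, has_chain p m -> has_chain (phi p) m.
Proof.
move=> phiK phi_le psi_le; elim=> //= m IH p [q [pq qp qm]].
exists (phi q); split; [exact: phi_le | | exact: IH].
by move/psi_le; rewrite !phiK.
Qed.

Lemma not_spec_leP (A : comNzRingType) (p q : spectrum A) :
  ~ spec_le q p -> exists2 a, avoids p a & ~~ avoids q a.
Proof.
apply: contra_notP => H a pa; apply: contrapT => /negP qa.
by apply: H; exists a.
Qed.

Lemma avoids0 (A : comNzRingType) (p : spectrum A) : avoids p 0 = false.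
Proof. by rewrite /avoids idealr0. Qed.

Lemma avoidsDl (A : comNzRingType) (p : spectrum A) a b :
  ~~ avoids p a -> avoids p (a + b) = avoids p b.
Proof.
rewrite /avoids negbK => pa; congr (~~ _); exact: rpredDl.
Qed.

Lemma avoids_prod (A : comNzRingType) (p : spectrum A) (I : Type) (r : seq I)
    (P : pred I) (F : I -> A) :
  avoids p (\prod_(i <- r | P i) F i) = \big[andb/true]_(i <- r | P i) avoids p (F i).
Proof. exact: (big_morph (avoids p) (avoidsM p) (avoids1 p)). Qed.

Definition cong (A : comNzRingType) (p : spectrum A) (a b : A) : Prop :=
  ~~ avoids p (a - b).

Lemma cong_refl (A : comNzRingType) (p : spectrum A) a : cong p a a.
Proof. by rewrite /cong subrr avoids0. Qed.

Lemma congD (A : comNzRingType) (p : spectrum A) a b c d :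
  cong p a b -> cong p c d -> cong p (a + c) (b + d).
Proof. by move=> ab cd; rewrite /cong opprD addrACA avoidsDl. Qed.

Lemma congM (A : comNzRingType) (p : spectrum A) a b c d :
  cong p a b -> cong p c d -> cong p (a * c) (b * d).
Proof.
rewrite /cong => ab cd.
have -> : a * c - b * d = (a - b) * c + b * (c - d).
  by rewrite mulrBl mulrBr addrA subrK.
by rewrite avoidsDl avoidsM negb_and ?cd ?orbT // ab.
Qed.

Lemma cong_avoids (A : comNzRingType) (p : spectrum A) a b :
  cong p a b -> avoids p a = avoids p b.
Proof. by move=> ab; rewrite -[a](subrK b) avoidsDl. Qed.

Lemma cong_mmap (k A : comNzRingType) (iota : {rmorphism k -> A})
    (p : spectrum A) n (y z : 'I_n -> A) G :
  (forall i, cong p (y i) (z i)) -> cong p (mmap iota y G) (mmap iota z G).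
Proof.
move=> yz; apply: big_ind2 => [||m _]; first exact: cong_refl.
  by move=> a b c d; apply: congD.
apply: congM; first exact: cong_refl.
apply: big_ind2 => [||i _]; first exact: cong_refl.
  by move=> a b c d; apply: congM.
elim: (m i) => [|e IH]; first by rewrite !expr0; apply: cong_refl.
by rewrite !exprS; apply: congM.
Qed.

(** Along a chain p = p_0 < ... < p_m, choose the values y so that each is in some
    p_(j+1) but not in p_j. These are algebraically independent modulo p. Indeed
    let G be a polynomial in the value taken at the first step, with coefficients
    that are polynomials in the later values. If its constant term is nonzero,
    then modulo p_1 only that term survives, and it is not in p_1 by induction;
    otherwise the first value, which is not in the prime p, can be factored out. *)
Lemma chain_alg_independent (k A : comNzRingType) (iota : {rmorphism k -> A})
    m (p : spectrum A) :
    (forall (q : spectrum A) c, c != 0 -> avoids q (iota c)) -> has_chain p m ->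
  exists y : 'I_m -> A, forall G, G != 0 -> avoids p (mmap iota y G).
Proof.
move=> units; elim: m p => [|m IH] p /=.
  move=> _; exists (fun=> 0) => G G0.
  have sG : (msize G <= 1)%N.
    rewrite msizeE; apply/bigmax_leqP_seq => u _ _.
    by rewrite mdegE big_ord0.
  rewrite (msize1_polyC sG) mmapC; apply: units.
  by apply: contra_neq G0 => c0; rewrite (msize1_polyC sG) c0.
move=> [q [pq /not_spec_leP[a pa qa] /IH[y yq]]].
exists (fun i => oapp y a (insub (val i))) => G /muni_neq0.
rewrite mmap_muni insubF ?ltnn //=.
have -> : (fun i => oapp y a (insub (widen_ord (leqnSn m) i : nat))) = y.
  by apply: funext => i; rewrite insubT //= => lt_im; congr y; apply: val_inj.
elim/poly_ind: (muni G) => [|H c IHH]; first by rewrite eqxx.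
rewrite rmorphD rmorphM /= map_polyX map_polyC /= hornerMXaddC.
have [->|c0 _] := eqVneq c 0.
  rewrite polyC0 addr0 => HX0.
  have H0 : H != 0 by apply: contraNneq HX0 => ->; rewrite mul0r.
  by rewrite rmorph0 addr0 avoidsM pa IHH.
by apply: pq; rewrite avoidsDl ?yq // avoidsM negb_and qa orbT.
Qed.

(** * Rings stratified by a simplicial complex *)
Section Stratification.
Variables (k A : comNzRingType) (iota : {rmorphism k -> A}).
Variables (V : finType) (x : V -> A).

(** The induction principle expressing that A is generated as a k-algebra by the
    x v. *)
Definition generates : Prop := forall P : A -> Prop,
  (forall c, P (iota c)) -> (forall v, P (x v)) ->
  (forall a b, P a -> P b -> P (a + b)) ->
  (forall a b, P a -> P b -> P (a * b)) -> forall a, P a.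

Definition support (p : spectrum A) : {set V} := [set v | avoids p (x v)].

(** The point p is the generic point of the closed set where x v vanishes for all
    v outside sigma. Up to inclusion both ways, sigma determines it. *)
Definition stratum_generic (sigma : {set V}) (p : spectrum A) : Prop :=
  forall q, spec_le p q <-> support q \subset sigma.

Lemma support_le p q : spec_le p q -> support q \subset support p.
Proof. by move=> pq; apply/subsetP => v; rewrite !inE; apply: pq. Qed.

(** What is used of the coordinate ring of a union of coordinate subspaces: every
    point lies in the torus of some face, and the coordinate subspace of each
    face is irreducible, with generic point in its torus. *)
Definition stratified (F : {set {set V}}) : Prop :=
  [/\ (forall sigma tau : {set V},
        sigma \in F -> tau \subset sigma -> tau \in F),
      (forall p, support p \in F) &
      (forall sigma, sigma \in F ->
        exists2 p, support p = sigma & stratum_generic sigma p)].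

Lemma stratum_support F p sigma : stratified F -> sigma \in F ->
  stratum_generic sigma p -> support p = sigma.
Proof.
move=> [_ _ Fp] /Fp[q qs qg] pg; apply/eqP; rewrite eqEsubset.
rewrite (pg p).1 //= -{1}qs; apply: support_le; apply/pg.
by rewrite qs.
Qed.

(** The coordinate subspaces of a full flag of faces below sigma form a chain. *)
Lemma stratum_chain F sigma p : stratified F -> sigma \in F ->
  stratum_generic sigma p -> has_chain p #|sigma|.
Proof.
move=> strF; have [Fc _ Fp] := strF.
move em: #|sigma| => m; elim: m sigma em p => //= m IH sigma sm p sF pg.
have [v vs] : exists v, v \in sigma by apply/card_gt0P; rewrite sm.
have tF : sigma :\ v \in F by apply: Fc sF (subD1set _ _).
have [q qt qg] := Fp _ tF.
exists q; split.
- by apply/pg; rewrite qt subD1set.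
- move/support_le; rewrite qt (stratum_support strF sF pg) => /subsetP/(_ _ vs).
  by rewrite !inE eqxx.
- by apply: (IH (sigma :\ v)) => //; move: sm; rewrite (cardsD1 v) vs => -[].
Qed.

End Stratification.

(** * Dimension of a coordinate subspace *)
Section Dimension.
Variables (k : fieldType) (A : comNzRingType) (iota : {rmorphism k -> A}).
Variables (V : finType) (x : V -> A).
Hypothesis gen : generates iota x.

Lemma avoids_scalar (q : spectrum A) c : c != 0 -> avoids q (iota c).
Proof.
move=> c0; have := avoids1 q.
by rewrite -(rmorph1 iota) -(mulfV c0) rmorphM avoidsM => /andP[].
Qed.

(** Modulo p the generators outside the support vanish, so as many generators as
    the support has elements suffice. *)
Lemma reduce_mod_support (p : spectrum A) (a : A) :
  exists g : {mpoly k[#|support x p|]},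
    cong p a (mmap iota (fun j => x (enum_val j)) g).
Proof.
elim/gen: a => [c|v|a b [g ag] [h bh]|a b [g ag] [h bh]].
- by exists c%:MP; rewrite mmapC; apply: cong_refl.
- have [pv|pv] := boolP (avoids p (x v)).
    have vs : v \in support x p by rewrite inE.
    exists 'X_(enum_rank_in vs v).
    by rewrite mmapX mmap1U enum_rankK_in //; apply: cong_refl.
  by exists 0; rewrite mmap0 /cong subr0.
- by exists (g + h); rewrite mmapD; apply: congD.
- by exists (g * h); rewrite rmorphM; apply: congM.
Qed.

(** A longer chain would give algebraically independent elements modulo p, more
    numerous than the generators of A modulo p. *)
Lemma chain_le_support (p : spectrum A) m : has_chain p m -> (m <= #|support x p|)%N.
Proof.
move=> /(chain_alg_independent avoids_scalar)[y yp]; rewrite leqNgt; apply/negP => lt.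
have [g yg] := boolp.choice (fun i => reduce_mod_support p (y i)).
have [G G0 Gg] := mpoly_alg_dependent g lt.
have := yp G G0; rewrite (cong_avoids (cong_mmap iota G yg)).
by rewrite -mmap_comp Gg mmap0 avoids0.
Qed.
End Dimension.

(** * Facets under an isomorphism of specialization orders *)
Definition facets (V : finType) (F : {set {set V}}) : {set {set V}} :=
  [set sigma | maxset (mem F) sigma].

(** The facets through w, where f reads each facet as a set of vertices
    of another complex. *)
Definition facet_label (V W : finType) (Fs : {set {set V}})
    (f : {set V} -> {set W}) (w : W) : {set {set V}} :=
  [set rho in Fs | w \in f rho].

Lemma in_facet_label (V W : finType) (Fs : {set {set V}}) (f : {set V} -> {set W})
    w rho :
  (rho \in facet_label Fs f w) = (rho \in Fs) && (w \in f rho).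
Proof. by rewrite inE. Qed.

Lemma facetP (V : finType) (F : {set {set V}}) sigma :
  reflect (sigma \in F /\ forall tau, tau \in F -> sigma \subset tau -> tau = sigma)
    (sigma \in facets F).
Proof. by rewrite inE; apply: (iffP maxsetP). Qed.

Lemma face_sub_facet (V : finType) (F : {set {set V}}) sigma :
  sigma \in F -> exists2 rho, rho \in facets F & sigma \subset rho.
Proof.
by move=> sF; have [rho rm sr] := maxset_exists sF; exists rho; rewrite ?inE.
Qed.

(** With f the identity this is the intersection of S; with f a map of facets, a
    family of facets of one complex indexes an intersection in another. *)
Definition meet_of (V W : finType) (f : {set V} -> {set W}) (S : {set {set V}}) :
  {set W} := [set w | [forall rho in S, w \in f rho]].

Lemma sub_meet_of (V W : finType) (f : {set V} -> {set W}) (S : {set {set V}})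
    (tau : {set W}) :
  reflect (forall rho, rho \in S -> tau \subset f rho) (tau \subset meet_of f S).
Proof.
apply: (iffP subsetP) => [H rho rS|H w wt].
  by apply/subsetP => w /H; rewrite inE => /forall_inP; apply.
by rewrite inE; apply/forall_inP => rho /H/subsetP; apply.
Qed.

Section FacetTransfer.
Variables (A B : comNzRingType) (V W : finType) (x : V -> A) (y : W -> B).
Variables (F : {set {set V}}) (G : {set {set W}}).
Hypotheses (strA : stratified x F) (strB : stratified y G).
Variables (phi : spectrum A -> spectrum B) (psi : spectrum B -> spectrum A).
Hypotheses (phiK : cancel phi psi) (psiK : cancel psi phi).
Hypotheses (phi_le : {homo phi : p q / spec_le p q})
  (psi_le : {homo psi : p q / spec_le p q}).

(** The generic points of the strata of facets are the minimal primes, a notion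
    that depends on the order only. *)
Lemma facet_transfer sigma p : sigma \in facets F -> stratum_generic x sigma p ->
  support y (phi p) \in facets G /\ stratum_generic y (support y (phi p)) (phi p).
Proof.
have [Fc Fs Fp] := strA; have [Gc Gs Gp] := strB.
move=> /facetP[sF sm] pg.
have pmin q : spec_le q p -> spec_le p q.
  move=> /(support_le x); rewrite (stratum_support strA sF pg) => sq; apply/pg.
  by rewrite (sm _ (Fs q) sq).
have phimin q : spec_le q (phi p) -> spec_le (phi p) q.
  move=> /psi_le; rewrite phiK => /pmin/phi_le; by rewrite psiK.
set tau := support y (phi p).
have [q qt qg] := Gp tau (Gs _).
have qphi : spec_le q (phi p) by apply/qg.
split.
  apply/facetP; split=> [|rho rG tr]; first exact: Gs.
  have [r rr rg] := Gp rho rG.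
  have /phimin/(support_le y) : spec_le r (phi p) by apply/rg.
  by rewrite rr => rt; apply/eqP; rewrite eqEsubset rt.
move=> r; split=> [/(support_le y) //|rt].
by apply: spec_le_trans (phimin _ qphi) _; apply/qg.
Qed.

End FacetTransfer.

Section Transfer.
Variables (k : fieldType) (A B : comNzRingType).
Variables (iotaA : {rmorphism k -> A}) (iotaB : {rmorphism k -> B}).
Variables (V W : finType) (x : V -> A) (y : W -> B).
Variables (F : {set {set V}}) (G : {set {set W}}).
Hypotheses (genA : generates iotaA x) (genB : generates iotaB y).
Hypotheses (strA : stratified x F) (strB : stratified y G).
Variables (phi : spectrum A -> spectrum B) (psi : spectrum B -> spectrum A).
Hypotheses (phiK : cancel phi psi) (psiK : cancel psi phi).
Hypotheses (phi_le : {homo phi : p q / spec_le p q})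
  (psi_le : {homo psi : p q / spec_le p q}).

(** The relation of corresponding facets, vacuous when sigma is not a facet so that
    a total function can be chosen in it. *)
Definition facet_match (sigma : {set V}) (tau : {set W}) : Prop :=
  sigma \in facets F -> tau \in facets G /\
    exists p, stratum_generic x sigma p /\ stratum_generic y tau (phi p).

Lemma facet_match_exists sigma : exists tau, facet_match sigma tau.
Proof.
have [sF|sF] := boolP (sigma \in facets F); last by exists set0 => /(negP sF).
have [sF' _] := facetP _ _ sF; have [_ _ /(_ _ sF')[p _ pg]] := strA.
have [tG tg] := facet_transfer strA strB phiK psiK phi_le psi_le sF pg.
by exists (support y (phi p)) => _; split=> //; exists p.
Qed.

Lemma facet_match_surj (beta : {set V} -> {set W}) tau :
    (forall sigma, facet_match sigma (beta sigma)) -> tau \in facets G ->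
  exists2 sigma, sigma \in facets F & beta sigma = tau.
Proof.
move=> betaP tG; have [tG' tmax] := facetP _ _ tG.
have [_ _ /(_ _ tG')[q qt qg]] := strB.
have [sF _] := facet_transfer strB strA psiK phiK psi_le phi_le tG qg.
exists (support x (psi q)) => //.
have [/facetP[bG _] [p [pg bg]]] := betaP _ sF.
apply: tmax => //; rewrite -qt; apply/bg; rewrite -[q]psiK.
by apply/phi_le/pg.
Qed.

(** The coordinate subspace of an intersection of facets is the intersection of
    their coordinate subspaces, so its generic point is the least prime above all
    theirs. The order isomorphism preserves least upper bounds and the length of
    chains, and the latter counts the vertices by [stratum_chain] and
    [chain_le_support]. *)
Lemma meet_transfer (beta : {set V} -> {set W}) (S : {set {set V}}) :
    (forall sigma, facet_match sigma (beta sigma)) ->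
    S \subset facets F -> S != set0 ->
  #|meet_of id S| = #|meet_of beta S|.
Proof.
move=> betaP /subsetP SF /set0Pn[rho0 r0S].
have [Fc Fs Fp] := strA; have [Gc Gs Gp] := strB.
set sigma := meet_of id S; set tau := meet_of beta S.
have sF : sigma \in F.
  have [r0F _] := facetP _ _ (SF _ r0S).
  by apply: Fc r0F _; move: (subxx sigma) => /sub_meet_of; apply.
have tG : tau \in G.
  have [/facetP[r0G _] _] := betaP _ (SF _ r0S).
  by apply: Gc r0G _; move: (subxx tau) => /sub_meet_of; apply.
have [p ps pg] := Fp _ sF; have [q qt qg] := Gp _ tG.
have uP rho : rho \in S -> exists2 u, stratum_generic x rho u &
    stratum_generic y (beta rho) (phi u).
  by move=> /SF/(betaP rho)[_ [u [ug uphi]]]; exists u.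
have pq : spec_le (phi p) q.
  rewrite -[q]psiK; apply/phi_le/pg/sub_meet_of => rho rS.
  have [u ug uphi] := uP _ rS; apply/ug; rewrite -[u]phiK; apply/psi_le/uphi.
  by rewrite qt; move: rho rS {u ug uphi}; apply/sub_meet_of.
have qp : spec_le q (phi p).
  apply/qg/sub_meet_of => rho rS.
  have [u ug uphi] := uP _ rS; apply/uphi/phi_le/ug.
  by rewrite ps; move: rho rS {u ug uphi}; apply/sub_meet_of.
apply/eqP; rewrite eqn_leq; apply/andP; split.
  rewrite -qt; apply: (chain_le_support genB); apply: has_chain_le qp _.
  apply: has_chain_iso phiK phi_le psi_le _ _ _.
  exact: stratum_chain strA sF pg.
rewrite -ps; apply: (chain_le_support genA).
rewrite -[p]phiK; apply: has_chain_iso psiK psi_le phi_le _ _ _.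
apply: has_chain_le pq _; exact: stratum_chain strB tG qg.
Qed.

End Transfer.

(** * Reconstruction of a cone from its facets *)

(** Moebius inversion over the subsets of X: descending induction on S subtracts
    the fibres over the proper supersets. *)
Lemma card_fiber_eq (X V W : finType) (l : V -> {set X}) (l' : W -> {set X}) :
    (forall S : {set X}, S != set0 ->
      #|[set v | S \subset l v]| = #|[set w | S \subset l' w]|) ->
    (forall v, l v != set0) -> (forall w, l' w != set0) ->
  forall S, #|[set v | l v == S]| = #|[set w | l' w == S]|.
Proof.
move=> le l0 l'0.
have split_card (U : finType) (h : U -> {set X}) (S : {set X}) :
    #|[set u | S \subset h u]| =
    (#|[set u | h u == S]| + \sum_(T : {set X} | S \proper T) #|[set u | h u == T]|)%N.
  transitivity (\sum_(T : {set X} | S \subset T) #|[set u | h u == T]|)%N.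
    rewrite -sum1_card (partition_big h (fun T : {set X} => S \subset T)) /=.
      by apply: eq_bigr => T ST; rewrite -sum1_card; apply: eq_bigl => u;
        rewrite !inE; case: eqP => [->|]; rewrite ?ST ?andbF.
    by move=> u; rewrite inE.
  rewrite (bigD1 S) //=; congr (_ + _)%N; apply: eq_bigl => T.
  by rewrite properEneq andbC eq_sym.
move=> S; have [m] := ubnP (#|X| - #|S|)%N; elim: m S => // m IH S Sm.
have [->|S0] := eqVneq S set0.
  have -> : [set v | l v == set0] = set0.
    by apply/setP => v; rewrite !inE (negPf (l0 v)).
  suff -> : [set w | l' w == set0] = set0 by rewrite !cards0.
  by apply/setP => w; rewrite !inE (negPf (l'0 w)).
have := le S S0; rewrite !split_card.
rewrite (eq_bigr (fun T => #|[set w | l' w == T]|)); first by move/addIn.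
move=> T ST; apply: IH; have := proper_card ST; have := max_card T; lia.
Qed.

Lemma fiberwise_bijection (L : eqType) n m (l : 'I_n -> L) (l' : 'I_m -> L) :
    (forall a, count_mem a (map l (enum 'I_n)) = count_mem a (map l' (enum 'I_m))) ->
  exists2 f : 'I_n -> 'I_m, bijective f & forall i, l i = l' (f i).
Proof.
move=> cnt.
have pe : perm_eq (map l (enum 'I_n)) (map l' (enum 'I_m)).
  by apply/allP => a _; apply/eqP/cnt.
have nm : n = m.
  by have := perm_size pe; rewrite (size_map l) (size_map l') !size_enum_ord.
subst m; have /tuple_permP[s sE] :
  perm_eq (map l (enum 'I_n)) (map_tuple l' (ord_tuple n)) := pe.
exists s; first exact/injF_bij/perm_inj.
move=> i; have := congr1 (fun t => nth (l i) t i) sE.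
rewrite (nth_map i) ?size_enum_ord // nth_ord_enum => ->.
rewrite (nth_map i) ?size_enum_ord // nth_ord_enum.
by rewrite tnth_map tnth_ord_tuple.
Qed.

Lemma card_option_fiber (L : eqType) n (l : option 'I_n -> L) a :
  #|[set v | l v == a]| =
    ((l None == a) + count_mem a (map (l \o Some) (enum 'I_n)))%N.
Proof.
have -> : count_mem a (map (l \o Some) (enum 'I_n)) = #|[set i | l (Some i) == a]|.
  rewrite count_map -size_filter enumT cardE; congr size.
  by apply: eq_filter => i; rewrite /= inE.
rewrite (cardsD1 None) inE; congr (_ + _)%N; rewrite -[RHS](card_imset _ Some_inj).
apply: eq_card => -[i|]; rewrite !inE /= ?(mem_imset _ _ Some_inj) ?inE //.
by apply/esym/negP => /imsetP[].
Qed.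

Section Cone.
(** The vertex [None] is the apex. *)
Definition cone n (Delta : simplicial_complex n) : {set {set option 'I_n}} :=
  [set sigma : {set option 'I_n} | [set i | Some i \in sigma] \in faces Delta].

Variables (n : nat) (Delta : simplicial_complex n).

Lemma cone_closed (sigma tau : {set option 'I_n}) :
  sigma \in cone Delta -> tau \subset sigma -> tau \in cone Delta.
Proof.
rewrite !inE => sD ts; apply: faces_closed sD _.
by apply/subsetP => i; rewrite !inE; apply: (subsetP ts).
Qed.

Lemma cone_facet_apex rho : rho \in facets (cone Delta) -> None \in rho.
Proof.
move=> /facetP[rF rm]; have F1 : None |: rho \in cone Delta.
  move: rF; rewrite !inE.
  suff -> : [set i | Some i \in None |: rho] = [set i | Some i \in rho] by [].
  by apply/setP => i; rewrite !inE.
by rewrite -(rm _ F1 (subsetUr _ _)) setU11.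
Qed.

Lemma cone_face (sigma : {set 'I_n}) :
  sigma \in faces Delta <->
  exists2 rho, rho \in facets (cone Delta) & forall i, i \in sigma -> Some i \in rho.
Proof.
split=> [sD|[rho /facetP[rF _] sr]]; last first.
  rewrite inE in rF; apply: faces_closed rF _.
  by apply/subsetP => i; rewrite inE; apply: sr.
have [rho rF sr] : exists2 rho, rho \in facets (cone Delta) &
    [set Some i | i in sigma] \subset rho.
  apply: face_sub_facet; rewrite inE.
  suff -> : [set i | Some i \in [set Some i | i in sigma]] = sigma by [].
  by apply/setP => i; rewrite inE (mem_imset _ _ Some_inj).
by exists rho => // i si; apply: (subsetP sr); apply: imset_f.
Qed.

Lemma cone_vertex v : exists2 rho, rho \in facets (cone Delta) & v \in rho.
Proof.
case: v => [i|].
  have [rho rF ri] := (cone_face [set i]).1 (faces_vertex Delta i).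
  by exists rho => //; apply: ri; rewrite inE.
pose i := Ordinal (ground_gt0 Delta).
have [rho rF _] := (cone_face [set i]).1 (faces_vertex Delta i).
by exists rho => //; apply: cone_facet_apex.
Qed.
End Cone.

Lemma sub_facet_label (V W : finType) (F : {set {set V}}) (f : {set V} -> {set W})
    (S : {set {set V}}) :
  [set w | S \subset facet_label F f w] =
    if S \subset F then meet_of f S else set0.
Proof.
apply/setP => w; rewrite inE; have [SF|SF] := boolP (S \subset F).
  rewrite inE; apply/subsetP/forall_inP => H rho rS; first by case/setIdP: (H _ rS).
  by rewrite inE (subsetP SF) //= H.
rewrite inE; apply: contraNF SF => /subsetP H.
by apply/subsetP => rho /H/setIdP[].
Qed.

(** Label each vertex of the two cones by the facets of the first one that
    contain it, facets of the second cone being read through beta. Each label is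
    shared by as many vertices on both sides, by [meet_transfer] and
    [card_fiber_eq]. The two apexes lie in all facets, so they have the same
    label; leaving them out, the base vertices still have equally large fibres,
    and a label-preserving bijection of the bases preserves membership in every
    facet. *)
Lemma cone_reconstruction (k : fieldType) (A B : comNzRingType)
    (iotaA : {rmorphism k -> A}) (iotaB : {rmorphism k -> B})
    n n' (Delta : simplicial_complex n) (Delta' : simplicial_complex n')
    (x : option 'I_n -> A) (y : option 'I_n' -> B)
    (phi : spectrum A -> spectrum B) (psi : spectrum B -> spectrum A) :
    generates iotaA x -> generates iotaB y ->
    stratified x (cone Delta) -> stratified y (cone Delta') ->
    cancel phi psi -> cancel psi phi ->
    {homo phi : p q / spec_le p q} -> {homo psi : p q / spec_le p q} ->
  simplicial_iso Delta Delta'.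
Proof.
move=> genA genB strA strB phiK psiK phi_le psi_le.
have [beta betaP] :=
  boolp.choice (facet_match_exists strA strB phiK psiK phi_le psi_le).
set F := facets (cone Delta).
pose l := facet_label F id; pose l' := facet_label F beta.
have surj tau := facet_match_surj strA strB phiK psiK phi_le psi_le (tau := tau) betaP.
have lE S : #|[set v | l v == S]| = #|[set w | l' w == S]|.
  apply: card_fiber_eq => [{}S S0|v|w].
  - rewrite !sub_facet_label; case: ifP => [SF|_]; last by rewrite !cards0.
    exact: (meet_transfer genA genB strA strB phiK psiK phi_le psi_le betaP SF S0).
  - have [rho rF vr] := cone_vertex Delta v.
    by apply/set0Pn; exists rho; rewrite in_facet_label rF.
  - have [tau tG wt] := cone_vertex Delta' w; have [rho rF rt] := surj _ tG.
    by apply/set0Pn; exists rho; rewrite in_facet_label rF rt.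
have lN : l None = l' None.
  apply/setP => rho; rewrite !in_facet_label; apply: andb_id2l => rF.
  rewrite (cone_facet_apex rF) (@cone_facet_apex _ Delta') //.
  by have [] := betaP _ rF.
have [f fb lf] : exists2 f : 'I_n -> 'I_n', bijective f &
    forall i, l (Some i) = l' (Some (f i)).
  apply: (fiberwise_bijection (l := l \o Some) (l' := l' \o Some)) => S.
  by apply: (@addnI (l None == S)); rewrite -card_option_fiber lE lN card_option_fiber.
exists f => // sigma; apply/idP/idP => /cone_face[rho rF sr]; apply/cone_face.
  exists (beta rho); first by have [] := betaP _ rF.
  move=> _ /imsetP[i si ->].
  have : rho \in l (Some i) by rewrite in_facet_label rF sr.
  by rewrite lf in_facet_label => /andP[].
have [rho' rF' rho'E] := surj _ rF; exists rho' => // i si.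
have : rho' \in l' (Some (f i)) by rewrite in_facet_label rF' rho'E sr ?imset_f.
by rewrite -lf in_facet_label => /andP[].
Qed.

(** * The strata of a Stanley-Reisner ring *)
Section QuotientLift.
Local Open Scope quotient_scope.
Variables (R : comNzRingType) (I : idealr R) (S : comNzRingType).
Variable f : {rmorphism R -> S}.
Hypothesis fI : forall a, a \in (I : {pred R}) -> f a = 0.

(** The hypothesis is kept as an argument, so that the morphism instances below
    apply to the constant itself. *)
Definition quot_lift of (forall a, a \in (I : {pred R}) -> f a = 0) :=
  fun a : {ideal_quot I} => f (repr a).

Local Notation lift := (quot_lift fI).

Lemma quot_liftE a : lift (\pi_({ideal_quot I}) a) = f a.
Proof.
apply/eqP; rewrite -subr_eq0 -rmorphB fI //.
by rewrite Quotient.idealrBE reprK.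
Qed.

Lemma quot_lift_zmod : zmod_morphism lift.
Proof.
move=> a b; rewrite -[a]reprK -[b]reprK -rmorphB /= !quot_liftE.
exact: rmorphB.
Qed.

Lemma quot_lift_monoid : monoid_morphism lift.
Proof.
split=> [|a b].
  by rewrite -[1](rmorph1 (\pi_({ideal_quot I}))) quot_liftE rmorph1.
rewrite -[a]reprK -[b]reprK -rmorphM /= !quot_liftE.
exact: rmorphM.
Qed.

HB.instance Definition _ := GRing.isZmodMorphism.Build {ideal_quot I} S lift
  quot_lift_zmod.
HB.instance Definition _ := GRing.isMonoidMorphism.Build {ideal_quot I} S lift
  quot_lift_monoid.

End QuotientLift.

Section KernelPoint.
Variables (A : comNzRingType) (D : idomainType) (f : {rmorphism A -> D}).

Let kernel : A -> bool := fun a => f a == 0.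

Let kernel_ideal : idealr_closed kernel.
Proof.
split=> [||a u v]; rewrite ?inE /in_mem /= /kernel ?rmorph0 ?rmorph1 ?oner_eq0 //.
by move=> /eqP u0 /eqP v0; rewrite rmorphD rmorphM u0 v0 mulr0 addr0.
Qed.

Let kernel_prime : prime_idealr_closed kernel.
Proof. by move=> u v; rewrite /in_mem /= /kernel rmorphM mulf_eq0. Qed.

Definition kernel_point : spectrum A := Prime kernel_ideal kernel_prime.

Lemma avoids_kernel a : avoids kernel_point a = (f a != 0).
Proof. by []. Qed.

End KernelPoint.

Section Generators.
Variables (k R S : comNzRingType) (iota : {rmorphism k -> R}).

Lemma generates_mpoly n : generates (@mpolyC n k) (fun i => 'X_i).
Proof.
move=> P Pk Px PD PM p; elim/mpolyind: p => [|c m p _ _ Pp].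
  by have := Pk 0; rewrite rmorph0.
apply: (PD) => //; rewrite -mul_mpolyC; apply: (PM); first exact: Pk.
rewrite mpolyXE_id; apply: big_ind => [||i _]; [exact: (Pk 1) | exact: PM |].
elim: (m i) => [|e IH]; first exact: (Pk 1).
by rewrite exprS; apply: (PM).
Qed.

Lemma generates_surj (V : finType) (x : V -> R) (f : {rmorphism R -> S}) :
    (forall b, exists a, f a = b) -> generates iota x ->
  generates (f \o iota) (f \o x).
Proof.
move=> f_surj gen P Pk Px PD PM b; have [a <-] := f_surj b.
elim/gen: a => [c|v|a a' Pa Pa'|a a' Pa Pa']; [exact: Pk | exact: Px | |].
  by rewrite rmorphD; apply: (PD).
by rewrite rmorphM; apply: (PM).
Qed.

Definition poly_var (V : finType) (x : V -> R) (v : option V) : {poly R} :=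
  if v is Some i then (x i)%:P else 'X.

Lemma generates_poly (V : finType) (x : V -> R) :
  generates iota x -> generates (polyC \o iota) (poly_var x).
Proof.
move=> gen P Pk Px PD PM; elim/poly_ind => [|p c Pp].
  by have := Pk 0; rewrite rmorph0.
apply: (PD); first by apply: (PM) => //; apply: (Px None).
elim/gen: c => [c|v|a b Pa Pb|a b Pa Pb]; [exact: Pk | exact: (Px (Some v)) | |].
  by rewrite rmorphD; apply: (PD).
by rewrite rmorphM; apply: (PM).
Qed.

End Generators.

Section StanleyReisnerStrata.
Local Open Scope quotient_scope.
Variables (k : fieldType) (n : nat) (Delta : simplicial_complex n).

Local Notation SR := (SR_ring k Delta).
Local Notation piSR := (\pi_({ideal_quot (@SR_ideal k n Delta : idealr {mpoly k[n]})})).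
Local Notation T := {poly {mpoly k[n]}}.

Definition SR_proj : {rmorphism {mpoly k[n]} -> SR} := piSR.

Definition SR_var : 'I_n -> SR := SR_proj \o (fun i => 'X_i).

Definition SR_scalar : {rmorphism k -> SR} := SR_proj \o @mpolyC n k.

Lemma SR_proj_surj b : exists a, SR_proj a = b.
Proof. by exists (repr b); apply: reprK. Qed.

Lemma SR_generates : generates SR_scalar SR_var.
Proof. exact: generates_surj SR_proj_surj (@generates_mpoly k n). Qed.

Lemma SR_nonface_eq0 sigma :
  sigma \notin faces Delta -> \prod_(i in sigma) SR_var i = 0.
Proof.
move=> sD; rewrite -(rmorph_prod SR_proj); apply/eqP.
rewrite -[X in _ == X](rmorph0 SR_proj) -Quotient.idealrBE subr0.
apply/asboolP; exists [:: (1, \prod_(i in sigma) 'X_i)]; split.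
  by move=> y; rewrite inE => /eqP ->; exists sigma.
by rewrite big_seq1 mul1r.
Qed.

Section UniversalProperty.
Variables (R : comNzRingType) (iota : {rmorphism k -> R}) (y : 'I_n -> R).
Hypothesis y0 : forall sigma, sigma \notin faces Delta -> \prod_(i in sigma) y i = 0.

Lemma SR_ideal_vanish a :
  a \in (@SR_ideal k n Delta : {pred {mpoly k[n]}}) -> mmap iota y a = 0.
Proof.
move=> /asboolP[c [cS ->]]; rewrite rmorph_sum big_seq big1 //= => b bc.
have [tau tD ->] := cS b bc; rewrite rmorphM rmorph_prod /=.
rewrite (eq_bigr y) ?y0 ?mulr0 // => i _.
by rewrite mmapX mmap1U.
Qed.

Definition SR_lift : {rmorphism SR -> R} := quot_lift SR_ideal_vanish.

Lemma SR_lift_scalar c : SR_lift (SR_scalar c) = iota c.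
Proof. by rewrite [LHS]quot_liftE [LHS]mmapC. Qed.

Lemma SR_lift_var i : SR_lift (SR_var i) = y i.
Proof. by rewrite [LHS]quot_liftE [LHS]mmapX mmap1U. Qed.

End UniversalProperty.

(** If the x_i outside p formed a nonface, their product, which is zero, would be
    outside p. *)
Lemma SR_support_face (p : spectrum {poly SR}) :
  support (poly_var SR_var) p \in cone Delta.
Proof.
rewrite inE; set sigma := [set i | _]; apply: contraT => sD.
have : avoids p (\prod_(i in sigma) poly_var SR_var (Some i)).
  rewrite avoids_prod big_andE; apply/forall_inP => i.
  by rewrite !inE.
by rewrite -rmorph_prod SR_nonface_eq0 // avoids0.
Qed.

Section Stratum.
Variable sigma : {set option 'I_n}.
Hypothesis sF : sigma \in cone Delta.

(** Restriction of functions to the coordinate subspace of sigma. *)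
Definition restrict_var (i : 'I_n) : T := if Some i \in sigma then ('X_i)%:P else 0.

Lemma restrict_var_nonface tau :
  tau \notin faces Delta -> \prod_(i in tau) restrict_var i = 0.
Proof.
move=> tD; have [i it iF] : exists2 i, i \in tau & Some i \notin sigma.
  apply/exists_inP; apply: contraNT tD; rewrite negb_exists_in => /forall_inP H.
  move: sF; rewrite inE => /faces_closed; apply.
  by apply/subsetP => i /H; rewrite negbK inE.
by rewrite (bigD1 i) //= /restrict_var (negPf iF) mul0r.
Qed.

Definition restrict_SR : {rmorphism SR -> T} :=
  SR_lift (polyC \o @mpolyC n k) restrict_var_nonface.

Lemma restrict_comm (b : T) : commr_rmorph restrict_SR b.
Proof. by move=> c; apply: mulrC. Qed.

Definition restrict : {rmorphism {poly SR} -> T} :=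
  horner_morph (restrict_comm (if None \in sigma then 'X else 0)).

Lemma restrict_polyC c : restrict c%:P = restrict_SR c.
Proof. exact: horner_morphC. Qed.

Lemma restrict_varE v :
  restrict (poly_var SR_var v) =
    if v \in sigma then (if v is Some i then ('X_i)%:P else 'X) else 0.
Proof.
case: v => [i|]; last exact: horner_morphX.
by rewrite restrict_polyC SR_lift_var.
Qed.

End Stratum.

(** The generic point of the stratum of sigma is the kernel of the restriction
    morphism. It lies below every prime q that contains the other variables:
    lifting a restricted function back to the ring changes it by an element of q
    only, as is seen on generators. *)
Lemma SR_stratified : stratified (poly_var SR_var) (cone Delta).
Proof.
split; [exact: cone_closed | exact: SR_support_face|].
move=> sigma sF; pose p := kernel_point (restrict sF).
have ps : support (poly_var SR_var) p = sigma.
  apply/setP => v; rewrite inE avoids_kernel restrict_varE.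
  case: ifP => // _; last by rewrite eqxx.
  case: v => [i|]; last by rewrite polyX_eq0.
  by rewrite polyC_eq0 -msize_poly_eq0 msizeX.
exists p => // q; split=> [/(support_le (poly_var SR_var))|qs]; first by rewrite ps.
pose back : {rmorphism T -> {poly SR}} := map_poly SR_proj.
have backE a : cong q a (back (restrict sF a)).
  elim/(generates_poly SR_generates): a => [c|v|a b|a b].
  - rewrite restrict_polyC SR_lift_scalar /back /= map_polyC.
    exact: cong_refl.
  - rewrite restrict_varE; case: ifPn => vs.
      case: v {vs} => [i|]; rewrite /back /= ?map_polyC ?map_polyX; exact: cong_refl.
    rewrite rmorph0 /cong subr0.
    by have := contraNN (subsetP qs v) vs; rewrite inE.
  - by rewrite !rmorphD; apply: congD.
  - by rewrite !rmorphM; apply: congM.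
move=> a qa; rewrite avoids_kernel; apply: contraTneq qa => ra0.
by rewrite (cong_avoids (backE a)) ra0 rmorph0 avoids0.
Qed.

End StanleyReisnerStrata.

(** * Functoriality of Spec *)
Section Comap.
Variables (A B : comNzRingType) (h : {rmorphism B -> A}).

Section Point.
Variable p : spectrum A.

Let comap_pred : B -> bool := fun b => h b \in prime_pred p.

Let comap_ideal : idealr_closed comap_pred.
Proof.
split=> [||a u v]; rewrite /in_mem /= /comap_pred ?rmorph0 ?rmorph1.
- exact: idealr0.
- by rewrite idealr1.
- by move=> pu pv; rewrite rmorphD rmorphM rpredD // idealMr.
Qed.

Let comap_prime : prime_idealr_closed comap_pred.
Proof. by move=> u v; rewrite /in_mem /= /comap_pred rmorphM prime_idealrM. Qed.

Definition comap : spectrum B := Prime comap_ideal comap_prime.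

Definition den_map (s : denominator comap) : denominator p :=
  exist (avoids p) (h (val s)) (valP s).

Definition loc_map (x : localization comap) : localization p :=
  frac (h (repr x).1) (den_map (repr x).2).

Lemma loc_mapE b s : loc_map (frac b s) = frac (h b) (den_map s).
Proof.
have : frac (repr (frac b s)).1 (repr (frac b s)).2 = frac b s.
  by rewrite -[RHS]reprK /frac -surjective_pairing.
move=> /fracP[u E]; apply/fracP; exists (den_map u).
by rewrite /= -!rmorphM -rmorphB -rmorphM E rmorph0.
Qed.

Lemma loc_map_zmod : zmod_morphism loc_map.
Proof.
elim/frac_ind=> a s; elim/frac_ind=> b t.
rewrite oppfrac addfrac !loc_mapE oppfrac addfrac -rmorphN -!rmorphM -rmorphD.
by apply: frac_eqE; rewrite /= rmorphM.
Qed.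

Lemma loc_map_monoid : monoid_morphism loc_map.
Proof.
split.
  rewrite -frac11 loc_mapE rmorph1 -frac11.
  by apply: frac_eqE; rewrite /= rmorph1.
elim/frac_ind=> a s; elim/frac_ind=> b t.
rewrite mulfrac !loc_mapE mulfrac -rmorphM.
by apply: frac_eqE; rewrite /= rmorphM.
Qed.
End Point.

Lemma comap_open (W : set (spectrum B)) : open W -> open (comap @^-1` W)%classic.
Proof.
move=> [S ->]; exists (h @` S)%classic; apply/seteqP; split=> p /=.
  by move=> [f Sf pf]; exists (h f) => //; exists f.
by move=> [_ [f Sf <-] pf]; exists f.
Qed.

Lemma comap_continuous : continuous comap.
Proof. by apply/continuousP => W; apply: comap_open. Qed.

Section Pull.
Variable U : set (spectrum B).

Definition pull_germs (s : germs U) : germs (comap @^-1` U)%classic :=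
  fun x => loc_map (s (exist U (comap (sval x)) (svalP x))).

Lemma pull_germs_regular s : s \in @regular B U -> pull_germs s \in @regular A _.
Proof.
move=> /regularP rs; apply/regularP => x.
have [W [f [g [oW Wx sW]]]] := rs (exist U (comap (sval x)) (svalP x)).
exists (comap @^-1` W)%classic, (h f), (h g); split=> //; first exact: comap_open.
move=> y Wy; have [gy sy] := sW (exist U (comap (sval y)) (svalP y)) Wy.
by exists gy; rewrite /pull_germs sy loc_mapE; apply: frac_eqE.
Qed.

Definition pull_section (s : sections U) : sections (comap @^-1` U)%classic :=
  Section (pull_germs_regular (germ_regular s)).

Lemma pull_section_zmod : zmod_morphism pull_section.
Proof. by move=> s t; apply: sectionsP => x; apply: loc_map_zmod. Qed.

Lemma pull_section_monoid : monoid_morphism pull_section.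
Proof.
split=> [|s t]; apply: sectionsP => x; first exact: (loc_map_monoid _).1.
exact: (loc_map_monoid _).2.
Qed.

HB.instance Definition _ := GRing.isZmodMorphism.Build (sections U) _
  pull_section pull_section_zmod.
HB.instance Definition _ := GRing.isMonoidMorphism.Build (sections U) _
  pull_section pull_section_monoid.

End Pull.
End Comap.

Lemma spectrum_eq (A : comNzRingType) (p q : spectrum A) :
  prime_pred p =1 prime_pred q -> p = q.
Proof.
case: p q => [p pi pp] [q qi qp] /= /funext pq; subst q.
by congr Prime; apply: Prop_irrelevance.
Qed.

Lemma comapK (A B : comNzRingType) (h : {rmorphism B -> A}) (g : {rmorphism A -> B}) :
  cancel g h -> cancel (comap h) (comap g).
Proof.
move=> gK p; apply: spectrum_eq => a.
by rewrite -[LHS]/(h (g a) \in prime_pred p) gK.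
Qed.

(** The stalk depends on the point, so the values at two equal points can only be
    compared through fractions that represent them. *)
Lemma germ_eq_point (A : comNzRingType) (U : set (spectrum A)) (s : germs U)
    p q (Up : U p) (Uq : U q) a (d : denominator q) (e : denominator p) :
  q = p -> s (exist U q Uq) = frac a d -> val d = val e -> s (exist U p Up) = frac a e.
Proof.
move=> qp; subst q => sq de; rewrite (germs_irr s Up Uq) sq.
exact: frac_eqE.
Qed.

Section SpecIso.
Variables (A B : comNzRingType) (h : {rmorphism B -> A}) (g : {rmorphism A -> B}).
Hypotheses (gK : cancel g h) (hK : cancel h g).

Lemma comap_preimage (U : set (spectrum B)) :
  (U `<=` comap g @^-1` (comap h @^-1` U))%classic.
Proof. by move=> p; rewrite /preimage /= comapK. Qed.

(** Pulling back along g gives a section over a preimage of a preimage, a set only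
    propositionally equal to U; hence the restriction. *)
Definition push_section (U : set (spectrum B))
    (t : sections (comap h @^-1` U)%classic) : sections U :=
  restr_section (@comap_preimage U) (pull_section g t).

Lemma frac_rep (C : comNzRingType) (p : spectrum C) (y : localization p) :
  exists a d, y = frac a d.
Proof. by elim/frac_ind: y => a d; exists a, d. Qed.

Lemma pull_sectionK U : cancel (@pull_section _ _ h U) (@push_section U).
Proof.
move=> s; apply: sectionsP => -[p Up].
have Uq : U (comap h (comap g p)) by rewrite comapK.
have [a [d sE]] := frac_rep (germ s (exist U _ Uq)).
have pd : avoids p (val d).
  exact: (eq_ind _ (fun q => is_true (avoids q (val d))) (valP d) _ (comapK hK p)).
rewrite [RHS](germ_eq_point (e := exist (avoids p) (val d) pd) Up (comapK hK p) sE erefl).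
transitivity (loc_map (loc_map (germ s (exist U _ Uq)))).
  by rewrite /= /restr_germs /pull_germs /=; do 2 congr loc_map; apply: germs_irr.
rewrite sE [X in loc_map X]loc_mapE loc_mapE hK; apply: frac_eqE => /=.
exact: hK.
Qed.

Lemma push_sectionK U : cancel (@push_section U) (@pull_section _ _ h U).
Proof.
move=> t; apply: sectionsP => -[p Up].
have Uq : (comap h @^-1` U)%classic (comap g (comap h p)).
  by rewrite /preimage /= (comapK gK).
have [a [d tE]] := frac_rep (germ t (exist (comap h @^-1` U)%classic _ Uq)).
have pd : avoids p (val d).
  exact: (eq_ind _ (fun q => is_true (avoids q (val d))) (valP d) _ (comapK gK p)).
rewrite [RHS](germ_eq_point (e := exist (avoids p) (val d) pd) Up (comapK gK p) tE erefl).
transitivity (loc_map (loc_map (germ t (exist (comap h @^-1` U)%classic _ Uq)))).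
  by rewrite /= /restr_germs /pull_germs /=; do 2 congr loc_map; apply: germs_irr.
rewrite tE [X in loc_map X]loc_mapE loc_mapE gK; apply: frac_eqE => /=.
exact: gK.
Qed.

End SpecIso.

Lemma Spec_isomorphic (k : comNzRingType) (A B : calgebra k)
    (h : {rmorphism B -> A}) (g : {rmorphism A -> B}) :
    cancel g h -> cancel h g ->
    (forall c, h (structure_map B c) = structure_map A c) ->
  isomorphic (Spec A) (Spec B).
Proof.
move=> gK hK hc.
unshelve econstructor; unshelve eapply RingedSpaceIso.
- exact: (comap h).
- exact: (comap g).
- by move=> U _; exact: (@pull_section _ _ h U).
- exact: comapK.
- exact: comapK.
- exact: comap_continuous.
- exact: comap_continuous.
- move=> U oU; exists (@push_section _ _ _ g hK U).
    exact: pull_sectionK.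
  exact: push_sectionK.
- move=> U V oU oV VU s; apply: sectionsP => x.
  by rewrite /= /pull_germs /restr_germs /=; congr loc_map; apply: germs_irr.
- move=> U oU c; apply: sectionsP => x.
  rewrite /= /pull_germs /const_germs loc_mapE -hc.
  by apply: frac_eqE; rewrite /= rmorph1.
Qed.

(** * The reconstruction theorem *)
Section Relabeling.
Variables (k : fieldType) (n n' : nat).
Variables (Delta : simplicial_complex n) (Delta' : simplicial_complex n').
Variable f : 'I_n -> 'I_n'.
Hypotheses (f_inj : injective f)
  (f_face : forall sigma : {set 'I_n},
    f @: sigma \in faces Delta' -> sigma \in faces Delta).

Lemma relabel_nonface (sigma : {set 'I_n}) : sigma \notin faces Delta ->
  \prod_(i in sigma) SR_var k Delta' (f i) = 0.
Proof.
move=> sD; rewrite -(big_imset (SR_var k Delta')) /=; last first.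
  by move=> i j _ _; apply: f_inj.
by apply: SR_nonface_eq0; apply: contraNN sD; apply: f_face.
Qed.

Definition SR_relabel : {rmorphism SR_ring k Delta -> SR_ring k Delta'} :=
  SR_lift (SR_scalar k Delta') relabel_nonface.
End Relabeling.

Lemma SR_relabelK (k : fieldType) n n' (Delta : simplicial_complex n)
    (Delta' : simplicial_complex n') (f : 'I_n -> 'I_n') (g : 'I_n' -> 'I_n)
    f_inj g_inj f_face g_face :
  cancel f g -> cancel (@SR_relabel k n n' Delta Delta' f f_inj f_face)
                  (@SR_relabel k n' n Delta' Delta g g_inj g_face).
Proof.
move=> fK a; elim/(@SR_generates k n Delta): a => [c|i|a b IHa IHb|a b IHa IHb].
- by rewrite !SR_lift_scalar.
- by rewrite !SR_lift_var fK.
- by rewrite !rmorphD IHa IHb.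
- by rewrite !rmorphM IHa IHb.
Qed.

Lemma SR_scheme_isomorphic (k : fieldType) n n' (Delta : simplicial_complex n)
    (Delta' : simplicial_complex n') :
  simplicial_iso Delta Delta' -> isomorphic (SR_scheme k Delta) (SR_scheme k Delta').
Proof.
move=> [f [g fK gK] fface].
have f_face (sigma : {set 'I_n}) : f @: sigma \in faces Delta' -> sigma \in faces Delta.
  by rewrite fface.
have g_face (sigma : {set 'I_n'}) :
    g @: sigma \in faces Delta -> sigma \in faces Delta'.
  by rewrite fface -imset_comp (eq_imset _ gK) imset_id.
pose h := SR_relabel k (can_inj fK) f_face; pose h' := SR_relabel k (can_inj gK) g_face.
apply: (@Spec_isomorphic k (SR_algebra k Delta) (SR_algebra k Delta') h' h).
- exact: SR_relabelK.
- exact: SR_relabelK.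
- move=> c; exact: SR_lift_scalar.
Qed.

Theorem corollary4p11 (k : closedFieldType) (char0 : [pchar k]%R =i pred0)
    (n n' : nat)
    (Delta : simplicial_complex n) (Delta' : simplicial_complex n') :
  isomorphic (SR_scheme_times_A1 k Delta) (SR_scheme_times_A1 k Delta') ->
  simplicial_iso Delta Delta' /\
  isomorphic (SR_scheme k Delta) (SR_scheme k Delta').
Proof.
move=> [I].
suff iso : simplicial_iso Delta Delta' by split=> //; apply: SR_scheme_isomorphic.
pose phi : spectrum {poly SR_ring k Delta} -> spectrum {poly SR_ring k Delta'} :=
  iso_map I.
pose psi : spectrum {poly SR_ring k Delta'} -> spectrum {poly SR_ring k Delta} :=
  iso_inv I.
apply: (cone_reconstruction
  (generates_poly (@SR_generates k n Delta))
  (generates_poly (@SR_generates k n' Delta'))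
  (@SR_stratified k n Delta) (@SR_stratified k n' Delta') (phi := phi) (psi := psi)).
- exact: (iso_mapK I).
- exact: (iso_invK I).
- have c : continuous phi := @iso_map_continuous _ _ _ I.
  exact: continuous_spec_le c.
- have c : continuous psi := @iso_inv_continuous _ _ _ I.
  exact: continuous_spec_le c.
Qed.
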